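(* Let $n$ be a positive integer. The map $\mathcal{F} \mapsto \mathcal{M}_{\mathcal{F}}$, which sends a convex rank test $\mathcal{F}$ on $S_n$ to the set of conditional independence statements labelling the walls of the $S_n$-fan that are removed when passing from the $S_n$-fan to $\mathcal{F}$, is a bijection from the set of convex rank tests on $S_n$ to the set of semi-graphoids on $[n]$.
   Context: $[n]=\{1,\dots,n\}$ and $S_n$ is the set of permutations of $[n]$. A permutation is written as its descent vector $\delta=(\delta_1,\dots,\delta_n)$ and corresponds to the open cone of all $u\in\mathbb{R}^n$ with $u_{\delta_1}>u_{\delta_2}>\cdots>u_{\delta_n}$. A fan in $\mathbb{R}^n$ is a finite collection $\mathcal{F}$ of polyhedral cones such that (i) every face of a cone in $\mathcal{F}$ is in $\mathcal{F}$, and (ii) the intersection of two cones in $\mathcal{F}$ is a face of each of them. Two vectors $u,v\in\mathbb{R}^n$ are permutation equivalent if for all $i,j\in[n]$: $u_i<u_j$ iff $v_i<v_j$, and $u_i=u_j$ iff $v_i=v_j$. The closures of the permutation equivalence classes form a fan, the $S_n$-fan; its maximal cones are $\{u : u_{\delta_1}\ge\cdots\ge u_{\delta_n}\}$, indexed by $\delta\in S_n$. A coarsening of the $S_n$-fan is a fan $\mathcal{F}$ such that every permutation equivalence class is contained in some cone of $\mathcal{F}$. It defines a partition of $S_n$: two permutations are in the same class iff the corresponding maximal cones of the $S_n$-fan lie in the same maximal cone of $\mathcal{F}$. A convex rank test is a partition of $S_n$ defined in this way by a coarsening of the $S_n$-fan; the test is identified with the fan $\mathcal{F}$. Two maximal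 cones of the $S_n$-fan, indexed by $\delta$ and $\delta'$, share a wall if there is an index $k$ with $\delta_k=\delta'_{k+1}$, $\delta_{k+1}=\delta'_k$ and $\delta_i=\delta'_i$ for all $i\ne k,k+1$. The wall $\{\delta,\delta'\}$ is labelled by the conditional independence (CI) statement $\delta_k \perp\!\!\!\perp \delta_{k+1}\mid\{\delta_1,\dots,\delta_{k-1}\}$. The wall is removed in passing to $\mathcal{F}$ iff $\delta$ and $\delta'$ are in the same class of the partition defined by $\mathcal{F}$. $\mathcal{M}_{\mathcal{F}}$ is the set of labels of the removed walls. The set of all CI statements is $\mathcal{T}_n=\{\, i\perp\!\!\!\perp j\mid K : i\neq j \text{ in } [n],\ K\subseteq[n]\setminus\{i,j\}\,\}$, where $i\perp\!\!\!\perp j\mid K$ and $j\perp\!\!\!\perp i\mid K$ are the same statement. A subset $\mathcal{M}\subseteq\mathcal{T}_n$ is a semi-graphoid if for all distinct $i,j,\ell\in[n]$ and all $K\subseteq[n]\setminus\{i,j,\ell\}$: if $i\perp\!\!\!\perp j\mid K\cup\{\ell\}\in\mathcal{M}$ and $i\perp\!\!\!\perp\ell\mid K\in\mathcal{M}$, then $i\perp\!\!\!\perp j\mid K\in\mathcal{M}$ and $i\perp\!\!\!\perp\ell\mid K\cup\{j\}\in\mathcal{M}$. *)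

(* Defs.v *)
From HB Require Import structures.
From mathcomp Require Import all_boot all_order all_algebra perm.
From mathcomp Require Import all_classical all_reals.

Set Implicit Arguments.
Unset Strict Implicit.
Unset Printing Implicit Defensive.

Import Order.TTheory GRing.Theory Num.Theory.

Local Open Scope classical_set_scope.
Local Open Scope ring_scope.

Section Fans.
Variables (R : realType) (n : nat).
Implicit Types (u v : 'cV[R]_n) (C D : set 'cV[R]_n) (F : set (set 'cV[R]_n)).

Definition polyhedral_cone C : Prop :=
  exists (m : nat) (A : 'M[R]_(m, n)),
    C = [set u | forall i, 0 <= (A *m u) i 0].

(* Taking w = 0 shows that a cone is a face of itself; every face of a cone
   contains the origin, so the empty set is not a face. *)
Definition face_of D C : Prop :=
  exists w : 'rV[R]_n,
    (forall u, C u -> 0 <= (w *m u) 0 0) /\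
    D = [set u | C u /\ (w *m u) 0 0 = 0].

Definition is_fan F : Prop :=
  [/\ finite_set F,
      forall C, F C -> polyhedral_cone C,
      forall C D, F C -> face_of D C -> F D
    & forall C D, F C -> F D -> face_of (C `&` D) C /\ face_of (C `&` D) D].

Definition perm_equiv u v : Prop :=
  forall i j : 'I_n,
    (u i 0 < u j 0 <-> v i 0 < v j 0) /\ (u i 0 = u j 0 <-> v i 0 = v j 0).

Definition Sn_coarsening F : Prop :=
  is_fan F /\
  forall u, exists C, F C /\ [set v | perm_equiv u v] `<=` C.

(* The maximal cone u_(delta_1) >= ... >= u_(delta_n) of the S_n-fan. *)
Definition Sn_cone (delta : 'S_n) : set 'cV[R]_n :=
  [set u | forall i j : 'I_n, (i <= j)%N -> u (delta j) 0 <= u (delta i) 0].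

Definition maximal_cone F C : Prop :=
  F C /\ forall D, F D -> C `<=` D -> D = C.

Definition same_maximal_cone F (delta delta' : 'S_n) : Prop :=
  exists C, [/\ maximal_cone F C, Sn_cone delta `<=` C & Sn_cone delta' `<=` C].

Definition fan_partition F : {set {set 'S_n}} :=
  equivalence_partition
    (fun delta delta' => `[< same_maximal_cone F delta delta' >])
    [set: 'S_n]%SET.

Definition convex_rank_test : set {set {set 'S_n}} :=
  [set P | exists F, Sn_coarsening F /\ P = fan_partition F].

End Fans.

Section ConditionalIndependence.
Variable n : nat.
Implicit Types (i j l : 'I_n) (K : {set 'I_n}) (delta : 'S_n).

(* The statement "i independent of j given K" is encoded as ({i, j}, K), which
   identifies it with "j independent of i given K"; not every pair of sets is
   a statement, see CI_statements. *)
Definition CI_type : Type := ({set 'I_n} * {set 'I_n})%type.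

Definition CI i j K : CI_type := ([set i; j]%SET, K).

Definition CI_statements : set CI_type :=
  [set t | exists i j K, [/\ i != j, K \subset ~: [set i; j]%SET & t = CI i j K]].

Definition semigraphoid : set (set CI_type) :=
  [set M | M `<=` CI_statements /\
    forall i j l K, uniq [:: i; j; l] -> K \subset ~: [set i; j; l]%SET ->
      M (CI i j (l |: K)%SET) -> M (CI i l K) ->
      M (CI i j K) /\ M (CI i l (j |: K)%SET)].

Definition share_wall delta (delta' : 'S_n) (k k' : 'I_n) : Prop :=
  [/\ k' = k.+1 :> nat, delta k = delta' k', delta k' = delta' k
    & forall i, i != k -> i != k' -> delta i = delta' i].

Definition wall_label delta (k k' : 'I_n) : CI_type :=
  CI (delta k) (delta k') [set delta i | i : 'I_n & (i < k)%N]%SET.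

Definition removed_CI (P : {set {set 'S_n}}) : set CI_type :=
  [set t | exists delta delta' k k',
    [/\ share_wall delta delta' k k', delta' \in finset.pblock P delta
      & t = wall_label delta k k']].

End ConditionalIndependence.

(* Main.v *)
Require Import Defs.
From HB Require Import structures.
From mathcomp Require Import all_boot all_order all_algebra fingroup perm.
From mathcomp Require Import all_classical all_reals.
From mathcomp Require Import zify.

(* Walls of the S_n-fan with the same label lie in one hyperplane and have a
   common point p with p + a and p - a in the chambers on their two sides.  As
   faces of a convex cone are extreme, a fan that removes one of these walls
   removes all of them.  The same argument around a codimension 2 cone whose six
   chambers form a hexagon gives the semigraphoid axiom, and by convexity a
   maximal cone is a union of chambers joined by geodesic galleries across
   removed walls, so that the removed labels determine the partition.

   Conversely, let a semigraphoid M be given, and call two chambers equivalent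
   when a gallery crossing only walls labelled in M joins them.  The square and
   hexagon relations show that all geodesics between equivalent chambers cross
   only such walls; hence a class consists of the linear extensions of the poset
   of the pairs ordered alike in the whole class, and it spans a polyhedral cone.
   The same relations show that two cones separated by a single wall meet in a
   common facet; crossing such walls one by one along a geodesic of chambers
   that contain a given point shows that any two cones meet in a common face. *)
Set Implicit Arguments.
Unset Strict Implicit.
Unset Printing Implicit Defensive.

Import Order.TTheory GRing.Theory Num.Theory.

(** * Adjacent transpositions and inversions *)

Section Positions.
Variable n : nat.
Implicit Types (d e : 'S_n) (a b c x y : 'I_n).

(** The zero-based place of [a] in the descent vector [d]; a smaller position means a larger
    coordinate on the chamber. *)
Definition pos d a : nat := (d^-1)%g a.

(** Products of permutations act from left to right, so the entries [a] and [b] of the descent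
    vector trade places; if they are adjacent, this crosses a wall. *)
Definition swap d a b : 'S_n := (d * tperm a b)%g.

Definition before_set d a : {set 'I_n} := [set c | pos d c < pos d a]%SET.

Lemma pos_inj d : injective (pos d).
Proof. by move=> a b /val_inj /perm_inj. Qed.

Lemma pos_lt d a : pos d a < n.
Proof. exact: ltn_ord. Qed.

Lemma pos_neq d a b : a != b -> pos d a <> pos d b.
Proof. by move=> /eqP ab /pos_inj. Qed.

Lemma pos_perm d (k : 'I_n) : pos d (d k) = k.
Proof. by rewrite /pos permK. Qed.

Lemma pos_ext d e : pos d =1 pos e -> d = e.
Proof.
move=> de; apply: invg_inj; apply/permP => a; exact/val_inj/de.
Qed.

Lemma pos_surj d (k : nat) : k < n -> exists a, pos d a = k.
Proof. by move=> kn; exists (d (Ordinal kn)); rewrite pos_perm. Qed.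

Lemma pos_swap d a b c : pos (swap d a b) c =
  if c == a then pos d b else if c == b then pos d a else pos d c.
Proof.
rewrite /pos /swap invMg tpermV permM; case: tpermP => [->|->|/eqP ca /eqP cb].
- by rewrite eqxx.
- by case: eqVneq => [->|_]; rewrite ?eqxx.
- by rewrite (negPf ca) (negPf cb).
Qed.

Lemma ord_neq_of_pos d a b : pos d a <> pos d b -> a != b.
Proof. by move=> ab; apply/eqP => E; apply: ab; rewrite E. Qed.

(** The number of hyperplanes that separate two chambers, hence their gallery distance; the
    inductions run on it. *)
Definition inversions d e : nat :=
  #|[set p : 'I_n * 'I_n | (pos d p.1 < pos d p.2) && (pos e p.2 < pos e p.1)]%SET|.

End Positions.

Ltac split_eq d x a :=
  case: (eqVneq x a) => [?|/[dup] ? /(@pos_neq _ d) ?];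
  [subst x; rewrite ?eqxx /= | idtac].

Section Inversions.
Variable n : nat.
Implicit Types (d e : 'S_n) (a b c x y : 'I_n).

Lemma inversions_swap d e a b : pos d b = (pos d a).+1 -> pos e b < pos e a ->
  (inversions (swap d a b) e).+1 = inversions d e.
Proof.
move=> ab ba; rewrite /inversions [RHS](cardsD1 (a, b)) !inE /=.
have -> /= : (pos d a < pos d b) && (pos e b < pos e a) by lia.
rewrite add1n; congr (_.+1); apply: eq_card => -[x y]; rewrite !inE xpair_eqE /=.
have ba' : b != a by apply/(@ord_neq_of_pos _ d); lia.
rewrite !pos_swap.
split_eq d x a; split_eq d y a; rewrite ?(negPf ba') ?eqxx //=; try lia.
- by split_eq d y b; lia.
- by split_eq d x b; rewrite ?(negPf ba') //=; lia.
- by split_eq d x b; split_eq d y b; lia.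
Qed.

Lemma inversions0 d e : inversions d e = 0 -> d = e.
Proof.
move=> /eqP; rewrite cards_eq0 => /eqP /setP inv0.
have le a b : pos d a < pos d b -> pos e a < pos e b.
  move=> ab; have := inv0 (a, b); rewrite !inE /= ab /=.
  have : a != b by apply/(@ord_neq_of_pos _ d); lia.
  by move=> /(@pos_neq _ e); lia.
have cnt f a : pos f a = #|before_set f a|.
  have -> : before_set f a = (f @: [set k : 'I_n | (k < pos f a)%N])%SET.
    apply/setP => x; rewrite inE; apply/idP/imsetP => [xa|[k + ->]].
      by exists ((f^-1)%g x); rewrite ?permKV // inE.
    by rewrite inE pos_perm.
  rewrite card_imset; last exact: perm_inj.
  rewrite -sum1_card (eq_bigl (fun k : 'I_n => k < pos f a)) => [|k]; last by rewrite inE.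
  by rewrite (big_ord_narrow (ltnW (pos_lt f a))) sum1_card card_ord.
apply: pos_ext => a; rewrite !cnt; apply: eq_card => x; rewrite !inE.
apply/idP/idP => [/le //|xa]; rewrite ltnNge leq_eqVlt; apply/norP; split.
  by apply/eqP => /pos_inj E; move: xa; rewrite E ltnn.
by apply/negP => /le; lia.
Qed.

(** Among the inverted pairs take one whose positions in [d] are closest: an entry between them
    would form a closer inverted pair with [a] or with [b]. *)
Lemma adjacent_inversion d e : d <> e ->
  exists a b, pos d b = (pos d a).+1 /\ pos e b < pos e a.
Proof.
move=> de; pose I (p : 'I_n * 'I_n) :=
  (pos d p.1 < pos d p.2) && (pos e p.2 < pos e p.1).
have [p0 Ip0] : exists p, I p.
  case: (pickP I) => [p Ip|no]; first by exists p.
  case: de; apply: inversions0.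
  by apply/eqP; rewrite cards_eq0; apply/eqP/setP => p; rewrite !inE; apply: no.
case: (@arg_minnP _ p0 I (fun p => pos d p.2 - pos d p.1) Ip0) => -[a b] /=.
rewrite /I => /andP[/= ab ba] mini; exists a, b; split=> //.
have [//|gap] : pos d b = (pos d a).+1 \/ (pos d a).+1 < pos d b by lia.
have [c pc] := pos_surj d (ltn_trans gap (pos_lt d b)).
have := mini (a, c); have := mini (c, b); rewrite /= pc.
have : c != a by apply/(@ord_neq_of_pos _ d); lia.
by move=> /(@pos_neq _ e); lia.
Qed.

Lemma perm_of_order (r : rel 'I_n) : irreflexive r -> transitive r ->
  (forall a b, a != b -> r a b || r b a) ->
  exists d, forall a b, (pos d a < pos d b) = r a b.
Proof.
move=> irr tr tot; pose S a : {set 'I_n} := [set x | r x a]%SET.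
have Sn a : #|S a| < n.
  rewrite -[n in _ < n]card_ord; apply: proper_card; apply/properP; split.
    exact/fintype.subsetP.
  by exists a; rewrite ?inE ?irr.
have lt a b : r a b -> #|S a| < #|S b|.
  move=> rab; apply: proper_card; apply/properP; split.
    by apply/fintype.subsetP => x; rewrite !inE => /tr; apply.
  by exists a; rewrite !inE ?irr.
have finj : injective (fun a => Ordinal (Sn a)).
  move=> a b [E]; apply/eqP/negPn/negP => /tot /orP[] /lt; rewrite E ltnn //.
(* The number of predecessors of [a] has to be its position, and [pos] reads the inverse
   permutation. *)
exists (perm finj)^-1%g => a b; rewrite /pos invgK !permE /=.
apply/idP/idP => [ab|/lt //]; have [E|/tot/orP[//|/lt/ltnW]] := eqVneq a b.
  by move: ab; rewrite E ltnn.
by rewrite leqNgt ab.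
Qed.

(** Among the chambers that contain the point [y], the one found here is nearest to [d], because
    ties keep the order of [d]. *)
Lemma lex_sort disp (T : orderType disp) (y : 'I_n -> T) d :
  exists e, forall a b, (pos e a < pos e b) =
    (y b < y a)%O || ((y a == y b) && (pos d a < pos d b)).
Proof.
apply: perm_of_order => [a|b a c|a b ab].
- by rewrite ltxx ltnn andbF.
- move=> /orP[ab|/andP[/eqP -> ab]] /orP[bc|/andP[/eqP <- bc]].
  + by rewrite (lt_trans bc ab).
  + by rewrite ab.
  + by rewrite bc.
  + by rewrite eqxx (ltn_trans ab bc) orbT.
- case: (ltgtP (y a) (y b)) => //= _.
  by have := @pos_neq _ d _ _ ab; lia.
Qed.

Lemma adjacent_of_none_between d a b : pos d a < pos d b ->
  (forall c, pos d a < pos d c -> pos d c < pos d b -> False) ->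
  pos d b = (pos d a).+1.
Proof.
move=> ab no; have [//|gap] : pos d b = (pos d a).+1 \/ (pos d a).+1 < pos d b.
  by lia.
have [c pc] := pos_surj d (ltn_trans gap (pos_lt d b)).
by case: (no c); lia.
Qed.

End Inversions.

Lemma eq_pos n (d : 'S_n) x a : (x == a) = (pos d x == pos d a).
Proof. by apply/eqP/eqP => [->|/pos_inj]. Qed.

Local Notation adjacent d a b := (pos d b = (pos d a).+1).

(** * Walls, their labels, squares and hexagons *)

Section Walls.
Variable n : nat.
Implicit Types (d e : 'S_n) (a b c x y : 'I_n) (K : {set 'I_n}).

Definition wall_CI d a b : CI_type n := CI a b (before_set d a).

Lemma adjacent_neq d a b : adjacent d a b -> a != b.
Proof. by move=> ab; apply/(@ord_neq_of_pos _ d); rewrite ab; lia. Qed.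

Lemma CIC a b K : CI a b K = CI b a K.
Proof. by rewrite /CI finset.setUC. Qed.

Lemma CI_inj a b K a' b' K' : a != b -> CI a b K = CI a' b' K' ->
  K' = K /\ ((a' = a /\ b' = b) \/ (a' = b /\ b' = a)).
Proof.
move=> ab [/setP E <-]; split=> //.
have := E b; have := E a; have := E b'; have := E a'.
rewrite !inE !eqxx !orbT /= => /orP[] /eqP -> /orP[] /eqP ->; auto.
  by rewrite orbb => _; rewrite eq_sym (negPf ab).
by rewrite orbb (negPf ab).
Qed.

Lemma swapC d a b : swap d a b = swap d b a.
Proof. by rewrite /swap tpermC. Qed.

Lemma swapK d a b : swap (swap d a b) b a = d.
Proof. by rewrite swapC /swap -mulgA tperm2 mulg1. Qed.

Lemma pos_swapl d a b : pos (swap d a b) a = pos d b.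
Proof. by rewrite pos_swap eqxx. Qed.

Lemma pos_swapr d a b : pos (swap d a b) b = pos d a.
Proof. by rewrite swapC pos_swapl. Qed.

Lemma pos_swap_out d a b x : x != a -> x != b -> pos (swap d a b) x = pos d x.
Proof. by move=> xa xb; rewrite pos_swap (negPf xa) (negPf xb). Qed.

Lemma adjacent_swap d a b : adjacent d a b -> adjacent (swap d a b) b a.
Proof. by rewrite pos_swapl pos_swapr. Qed.

Lemma before_set_succ d a b : adjacent d a b ->
  before_set d b = (a |: before_set d a)%SET.
Proof. by move=> ab; apply/setP => x; rewrite !inE (eq_pos d); lia. Qed.

Lemma before_set_swapr d a b : adjacent d a b ->
  before_set (swap d a b) b = before_set d a.
Proof.
move=> ab; apply/setP => x; rewrite !inE pos_swapr pos_swap !(eq_pos d).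
by case: eqP => ?; last case: eqP => ?; lia.
Qed.

Lemma before_set_swapl d a b : adjacent d a b ->
  before_set (swap d a b) a = (b |: before_set d a)%SET.
Proof.
move=> ab; rewrite (before_set_succ (adjacent_swap ab)) before_set_swapr //.
Qed.

Lemma before_set_swap_out d a b x : adjacent d a b -> x != a -> x != b ->
  before_set (swap d a b) x = before_set d x.
Proof.
move=> ab xa xb; apply/setP => y; rewrite !inE (pos_swap_out _ xa xb) pos_swap !(eq_pos d).
move: (pos_neq (d := d) xa) (pos_neq (d := d) xb).
by case: eqP => ?; last case: eqP => ?; lia.
Qed.

Lemma wall_CI_swap d a b : adjacent d a b ->
  wall_CI (swap d a b) b a = wall_CI d a b.
Proof. by move=> ab; rewrite /wall_CI CIC before_set_swapr. Qed.

Lemma wall_CI_statement d a b : adjacent d a b -> CI_statements (wall_CI d a b).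
Proof.
move=> ab; exists a, b, (before_set d a); split=> //; first exact: adjacent_neq ab.
by apply/fintype.subsetP => x; rewrite !inE !(eq_pos d); lia.
Qed.

Lemma swap_braid d a b c : a != b -> a != c -> b != c ->
  swap (swap (swap d a b) a c) b c = swap (swap (swap d b c) a c) a b.
Proof.
move=> ab ac bc; apply: pos_ext => x.
rewrite !pos_swap ?eqxx !(eq_sym b a) !(eq_sym c a) !(eq_sym c b).
rewrite !(negPf ab) !(negPf ac) !(negPf bc).
have [E|_] := eqVneq x a; first by rewrite ?E ?(negPf ab) ?(negPf ac).
by have [E|_] := eqVneq x b; rewrite ?E ?(negPf bc).
Qed.

Lemma swap_comm d a b x y : a != x -> a != y -> b != x -> b != y ->
  swap (swap d a b) x y = swap (swap d x y) a b.
Proof.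
move=> ax ay bx by_; apply: pos_ext => z.
rewrite !pos_swap !(eq_sym x) !(eq_sym y).
rewrite !(negPf ax) !(negPf ay) !(negPf bx) !(negPf by_).
have [E|_] := eqVneq z a; first by rewrite ?E ?(negPf ax) ?(negPf ay).
by have [E|_] := eqVneq z b; rewrite ?E ?(negPf bx) ?(negPf by_).
Qed.

(** The square relation: disjoint adjacent pairs can be exchanged independently, and the set of
    entries before one pair is not affected by exchanging the other. *)
Lemma adjacent_swap_far d a b x y : adjacent d a b -> adjacent d x y ->
  a != x -> a != y -> b != x -> 
  [/\ b != y, adjacent (swap d a b) x y & wall_CI (swap d a b) x y = wall_CI d x y].
Proof.
move=> ab xy ax ay bx.
have by_ : b != y by rewrite (eq_pos d); move: (pos_neq (d := d) ax); lia.
split=> //; first by rewrite !pos_swap_out // eq_sym.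
by rewrite /wall_CI before_set_swap_out // eq_sym.
Qed.

(* The two sides of the hexagon [abc], [acb], [cab], [cba], [bca], [bac]. *)
Lemma hexagon d a b c : adjacent d a b -> adjacent d b c ->
  let K := before_set d a in
  let d1 := swap d b c in let d2 := swap d1 a c in let d3 := swap d2 a b in
  let e1 := swap d a b in let e2 := swap e1 a c in
  [/\ swap e2 b c = d3,
      [/\ adjacent d1 a c, adjacent d2 a b, adjacent d3 c b
        & adjacent e1 a c /\ adjacent e2 b c],
      [/\ wall_CI d a b = CI a b K, wall_CI e1 a c = CI a c (b |: K)%SET
        & wall_CI e2 b c = CI b c K],
      [/\ wall_CI d b c = CI b c (a |: K)%SET, wall_CI d1 a c = CI a c K
        & wall_CI d2 a b = CI a b (c |: K)%SET]
    & [/\ a != b, a != c & b != c] /\ [/\ a \notin K, b \notin K & c \notin K]].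
Proof.
move=> ab bc K d1 d2 d3 e1 e2.
have nab := adjacent_neq ab; have nbc := adjacent_neq bc.
have nac : a != c by rewrite (eq_pos d) bc ab; lia.
have nba : b != a by rewrite eq_sym. have nca : c != a by rewrite eq_sym.
have ncb : c != b by rewrite eq_sym.
have A1 : adjacent d1 a c by rewrite (pos_swap_out _ nab nac) pos_swapr ab.
have A2 : adjacent d2 a b.
  by rewrite pos_swapl (pos_swap_out _ nba nbc) pos_swapr pos_swapl bc.
have A3 : adjacent d3 c b.
  rewrite pos_swapr (pos_swap_out _ nca ncb) pos_swapl !pos_swapr.
  by rewrite (pos_swap_out _ nab nac).
have B1 : adjacent e1 a c by rewrite pos_swapl (pos_swap_out _ nca ncb).
have B2 : adjacent e2 b c.
  by rewrite pos_swapr (pos_swap_out _ nba nbc) pos_swapl pos_swapr.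
split; [exact: swap_braid|by []| | |].
- split=> //; rewrite /wall_CI; first by rewrite (before_set_swapl ab).
  by rewrite (before_set_swap_out B1 nba nbc) (before_set_swapr ab).
- split; rewrite /wall_CI; first by rewrite (before_set_succ ab).
    by rewrite (before_set_swap_out bc nab nac).
  by rewrite (before_set_swapl A1) (before_set_swap_out bc nab nac).
- by split=> //; rewrite /K !inE; split; lia.
Qed.

End Walls.

(** * Galleries crossing walls of a semigraphoid *)

Section Semigraphoid.
Variables (n : nat) (M : set (CI_type n)).
Hypothesis sgM : semigraphoid M.
Implicit Types (d e : 'S_n) (a b c x y : 'I_n) (K : {set 'I_n}).

Lemma semigraphoid_exchange a b c K : a != b -> a != c -> b != c ->
  a \notin K -> b \notin K -> c \notin K ->
  M (CI a b (c |: K)%SET) -> M (CI a c K) ->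
  M (CI a b K) /\ M (CI a c (b |: K)%SET).
Proof.
move=> ab ac bc aK bK cK; apply: sgM.2.
  by rewrite /= !inE negb_or ab ac bc.
apply/fintype.subsetP => x xK; rewrite !inE !negb_or.
by apply/andP; split; [apply/andP; split|]; apply: contraTneq xK => ->.
Qed.

(* [geodesic e d]: every geodesic gallery from [d] to [e] crosses only walls
   whose label is in [M]. *)
Inductive geodesic e : 'S_n -> Prop :=
| geodesic_refl : geodesic e e
| geodesic_step d :
    (forall a b, adjacent d a b -> pos e b < pos e a -> M (wall_CI d a b)) ->
    (forall a b, adjacent d a b -> pos e b < pos e a ->
       geodesic e (swap d a b)) ->
    geodesic e d.

Lemma geodesic_inv e d a b : geodesic e d -> adjacent d a b ->
  pos e b < pos e a -> M (wall_CI d a b) /\ geodesic e (swap d a b).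
Proof. by case=> [|{}d Md gd] ab ba; [lia | split; [exact: Md | exact: gd]]. Qed.

(** Induction on the distance to [e]. If the wall leads away from [e], each wall of the new chamber
    that leads back towards [e] is compared with walls of [d], around a hexagon if the two pairs
    share one entry and around a square if they are disjoint. *)
Lemma geodesic_swap e d a b : geodesic e d -> adjacent d a b ->
  M (wall_CI d a b) -> geodesic e (swap d a b).
Proof.
have [m] := ubnP (inversions d e); elim: m d a b => // m IH d a b lt_m.
move=> gd ab Mab; have [ba|ab_e] := ltnP (pos e b) (pos e a).
  by have [] := geodesic_inv gd ab ba.
have {}ab_e : pos e a < pos e b.
  by have := pos_neq (d := e) (adjacent_neq ab); lia.
suff S x y : adjacent (swap d a b) x y -> pos e y < pos e x ->
    M (wall_CI (swap d a b) x y) /\ geodesic e (swap (swap d a b) x y).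
  by apply: geodesic_step => x y xy yx; case: (S x y xy yx).
move=> xy yx; have [E|xb] := eqVneq x b.
  have {E xy} [Ex Ey] : x = b /\ y = a.
    split=> //; apply/(@pos_inj _ (swap d a b)); rewrite xy E.
    by rewrite pos_swapl pos_swapr ab.
  by rewrite Ex Ey wall_CI_swap // swapK.
have ya : y != a.
  apply: contra_neq xb => Ey; apply/(@pos_inj _ (swap d a b)).
  by move: xy; rewrite Ey pos_swapl pos_swapr ab; lia.
have [Ex|xa] := eqVneq x a; last have [Ey|yb] := eqVneq y b.
(* Here [d] reads [a b y] and [e] has the order [y a b]. Two steps from [d] towards [e] give two
   labels, and the axiom, applied twice, gives those on the other side of the hexagon. The induction
   hypothesis is then used at [y a b] and at [y b a], both nearer to [e] than [d]. *)
- subst x; have ny : y != b by apply: contraTneq yx => ->; lia.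
  have bc : adjacent d b y by move: xy; rewrite pos_swapl pos_swap_out.
  have [E [A1 A2 A3 [B1 B2]] [L1 L2 L3] [L4 L5 L6] [[nab nac nbc] [aK bK cK]]]
    := hexagon ab bc.
  have yb_e : pos e y < pos e b by lia.
  have [Mbc g1] := geodesic_inv gd bc yb_e.
  have [Mac g2] := geodesic_inv g1 A1 yx.
  have i1 := inversions_swap bc yb_e; have i2 := inversions_swap A1 yx.
  rewrite L1 in Mab; rewrite L4 in Mbc; rewrite L5 in Mac.
  have [Mbc0 Mabc] : M (CI b y (before_set d a)) /\
      M (CI b a (y |: before_set d a)%SET).
    apply: semigraphoid_exchange => //; rewrite 1?(eq_sym b) 1?(eq_sym y) //.
    by rewrite CIC.
  have [_ Macb] : M (CI a b (before_set d a)) /\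
      M (CI a y (b |: before_set d a)%SET).
    by apply: semigraphoid_exchange => //; rewrite CIC.
  split; first by rewrite L2.
  have g3 : geodesic e (swap (swap (swap d b y) a y) a b).
    by apply: IH => //; [lia | rewrite L6 CIC].
  have i3 : (inversions (swap (swap d b y) a y) e).+1 =
      inversions (swap (swap (swap d b y) a y) a b) e.
    by rewrite -(inversions_swap (adjacent_swap A2) ab_e) swapK.
  rewrite -(swapK (swap (swap d a b) a y) b y) E.
  by apply: IH => //; [lia | rewrite -E wall_CI_swap // L3].
(* The other hexagon: [d] reads [x a b] and [e] has the order [a b x]. *)
- subst y; have ca : adjacent d x a.
    by move: xy; rewrite pos_swapr pos_swap_out.
  have [E [A1 A2 A3 [B1 B2]] [L1 L2 L3] [L4 L5 L6] [[nab nac nbc] [aK bK cK]]]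
    := hexagon ca ab.
  have [Mxa g1] := geodesic_inv gd ca (ltn_trans ab_e yx).
  have [Mxb g2] := geodesic_inv g1 B1 yx.
  have i1 := inversions_swap ca (ltn_trans ab_e yx).
  have i2 := inversions_swap B1 yx.
  rewrite L4 in Mab; rewrite L1 in Mxa; rewrite L2 in Mxb.
  have [Mab0 _] : M (CI a b (before_set d x)) /\
      M (CI a x (b |: before_set d x)%SET).
    apply: semigraphoid_exchange; rewrite // 1?(eq_sym a) 1?(eq_sym b) //.
    by rewrite CIC.
  have [Mxb0 Mxab] : M (CI x b (before_set d x)) /\
      M (CI x a (b |: before_set d x)%SET).
    by apply: semigraphoid_exchange; rewrite // 1?(eq_sym b).
  split; first by rewrite L5.
  have g3 : geodesic e (swap (swap (swap d x a) x b) a b).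
    by apply: IH => //; [lia | rewrite L3].
  have i3 : (inversions (swap (swap d x a) x b) e).+1 =
      inversions (swap (swap (swap d x a) x b) a b) e.
    by rewrite -(inversions_swap (adjacent_swap B2) ab_e) swapK.
  rewrite -(swapK (swap (swap d a b) x b) x a) -E.
  apply: IH => //; first by lia.
    by rewrite E; apply: adjacent_swap.
  by rewrite E wall_CI_swap // L6.
- have [nax nay nbx nby] : [/\ a != x, a != y, b != x & b != y].
    by split; rewrite eq_sym.
  have [_ xy' Exy] := adjacent_swap_far (adjacent_swap ab) xy nbx nby nax.
  rewrite swapK in xy' Exy.
  have [Mxy g1] := geodesic_inv gd xy' yx.
  have i1 := inversions_swap xy' yx.
  have [_ ab' Eab] := adjacent_swap_far xy' ab xa xb ya.
  rewrite -Exy swap_comm //; split=> //.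
  by apply: IH => //; [lia | rewrite Eab].
Qed.

End Semigraphoid.

(** * Equivalence classes of chambers and their posets *)

Section Classes.
Variables (n : nat) (M : set (CI_type n)).
Hypothesis sgM : semigraphoid M.
Implicit Types (d e f : 'S_n) (a b c x y : 'I_n).

Definition cross : rel 'S_n := fun d e =>
  `[< exists a b, [/\ adjacent d a b, M (wall_CI d a b) & e = swap d a b] >].

Definition gallery_class : rel 'S_n := connect cross.

Lemma gallery_class_sym : symmetric gallery_class.
Proof.
apply: sym_connect_sym => d e.
suff S f g : cross f g -> cross g f by apply/idP/idP; apply: S.
move=> /asboolP[a [b [ab Mab ->]]]; apply/asboolP; exists b, a.
by rewrite wall_CI_swap // swapK; split=> //; apply: adjacent_swap.
Qed.

Lemma gallery_class_swap d a b : adjacent d a b -> M (wall_CI d a b) ->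
  gallery_class d (swap d a b).
Proof. by move=> ab Mab; apply: connect1; apply/asboolP; exists a, b. Qed.

Lemma gallery_class_geodesic d e : gallery_class e d -> geodesic M e d.
Proof.
move=> /connectP[p ep ->]; elim/last_ind: p ep => [_|p f IH].
  exact: geodesic_refl.
rewrite rcons_path last_rcons => /andP[/IH gp /asboolP[a [b [ab Mab ->]]]].
exact: geodesic_swap.
Qed.

(** Convexity of the classes: the wall is the first one on some geodesic from [d] to [e]. *)
Lemma wall_CI_removed d e a b : gallery_class d e -> adjacent d a b ->
  pos e b < pos e a -> M (wall_CI d a b).
Proof.
rewrite gallery_class_sym => /gallery_class_geodesic de ab ba.
by case: (geodesic_inv de ab ba).
Qed.

Definition class_order d : {set 'I_n * 'I_n} :=
  [set p | [forall e, gallery_class d e ==> (pos e p.1 < pos e p.2)]]%SET.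

Lemma class_orderP d a b : reflect
  (forall e, gallery_class d e -> pos e a < pos e b) ((a, b) \in class_order d).
Proof. by rewrite inE; apply: (iffP forallP) => H e; apply/implyP/H. Qed.

Lemma class_order_eq d e : gallery_class d e -> class_order d = class_order e.
Proof.
move=> de; apply/setP => -[a b]; apply/class_orderP/class_orderP => H f ?; apply: H.
  exact: connect_trans de _.
by apply: connect_trans; first by rewrite -/gallery_class gallery_class_sym; exact: de.
Qed.

(** The member [f] of the class nearest to [e] is [e] itself. Otherwise some wall of [f] leads
    towards [e]; as [e] respects the class order, some member of the class lies beyond the
    hyperplane of this wall, so convexity puts its label in [M], and crossing it stays in the class
    and comes nearer. *)
Lemma linear_extension d e :
  (forall a b, (a, b) \in class_order d -> pos e a < pos e b) -> gallery_class d e.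
Proof.
move=> ext; case: (@arg_minnP _ d (gallery_class d) (fun f => inversions f e)).
  exact: connect0.
move=> f df minf; have [<- //|/eqP fe] := eqVneq f e.
have [a [b [ab ba]]] := adjacent_inversion fe.
have [f' df' ba'] : exists2 f', gallery_class d f' & pos f' b < pos f' a.
  apply: contrapT => no; have : (a, b) \in class_order d; last by move/ext; lia.
  apply/class_orderP => g dg; rewrite ltnNge leq_eqVlt; apply/norP; split.
    by apply/eqP => /pos_inj E; move: ab; rewrite E; lia.
  by apply/negP => ?; apply: no; exists g.
have Mab : M (wall_CI f a b).
  apply: (wall_CI_removed (e := f')) => //.
  by apply: connect_trans df'; rewrite -/gallery_class gallery_class_sym.
have := minf _ (connect_trans df (gallery_class_swap ab Mab)).
by rewrite -(inversions_swap ab ba) ltnn.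
Qed.

(** [f] is moved to [d] within its class, along one side of a square or hexagon at a time, so that
    [a] and [b] are adjacent again after each move. The opposite side, whose labels are in [M] too,
    carries [swap f a b] along. *)
Lemma gallery_class_swap_facet d f a b :
  adjacent d a b -> gallery_class d f -> adjacent f a b ->
  gallery_class (swap f a b) (swap d a b).
Proof.
move=> dab; have [m] := ubnP (inversions f d); elim: m f => // m IH f lt_m df fab.
have [->|/eqP fd] := eqVneq f d; first exact: connect0.
have [x [y [xy yx]]] := adjacent_inversion fd.
have i1 := inversions_swap xy yx.
have fd' : gallery_class f d by rewrite gallery_class_sym.
have Mxy := wall_CI_removed fd' xy yx.
have df1 := connect_trans df (gallery_class_swap xy Mxy).
have fd1 : gallery_class (swap f x y) d by rewrite gallery_class_sym.
have [E|xb] := eqVneq x b.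
  (* In [d] the entry [y] precedes [b], hence also its neighbour [a], so the path continues from
     [a y b] to [y a b]. *)
  subst x; have [E [A1 A2 A3 [B1 B2]] [L1 L2 L3] [L4 L5 L6]] := hexagon fab xy.
  move=> [[nab nac nbc] [aK bK cK]].
  have ya : pos d y < pos d a by have := @pos_neq _ d _ _ nac; lia.
  have Mac := wall_CI_removed fd1 A1 ya.
  have i2 := inversions_swap A1 ya.
  have df2 := connect_trans df1 (gallery_class_swap A1 Mac).
  rewrite L4 in Mxy; rewrite L5 in Mac.
  have [Myb Mya] : M (CI y b (before_set f a)) /\
      M (CI y a (b |: before_set f a)%SET).
    by apply: (semigraphoid_exchange sgM); rewrite // 1?CIC // eq_sym.
  have /IH /(_ df2 A2) : inversions (swap (swap f b y) a y) d < m by lia.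
  rewrite -E => h.
  apply: connect_trans h; apply: (@connect_trans _ _ (swap (swap f a b) a y)).
    by apply: gallery_class_swap; rewrite // L2 CIC.
  by apply: gallery_class_swap; rewrite // L3 CIC.
have [E|ya] := eqVneq y a.
  subst y; have [E [A1 A2 A3 [B1 B2]] [L1 L2 L3] [L4 L5 L6]] := hexagon xy fab.
  move=> [[nab nac nbc] [aK bK cK]].
  have bx : pos d b < pos d x by have := @pos_neq _ d _ _ nac; lia.
  have Mxb := wall_CI_removed fd1 B1 bx.
  have i2 := inversions_swap B1 bx.
  have df2 := connect_trans df1 (gallery_class_swap B1 Mxb).
  rewrite L1 in Mxy; rewrite L2 in Mxb.
  have [Mxb0 Mxab] : M (CI x b (before_set f x)) /\
      M (CI x a (b |: before_set f x)%SET).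
    by apply: (semigraphoid_exchange sgM); rewrite // eq_sym.
  have /IH /(_ df2 B2) : inversions (swap (swap f x a) x b) d < m by lia.
  rewrite E => h.
  apply: connect_trans h; apply: (@connect_trans _ _ (swap (swap f a b) x b)).
    by apply: gallery_class_swap; rewrite // L5.
  by apply: gallery_class_swap; rewrite // L6.
have xa : x != a.
  apply: contraTneq yx => E; subst x; have -> : y = b by apply/(@pos_inj _ f); lia.
  by lia.
rewrite eq_sym in xa; rewrite eq_sym in xb; rewrite eq_sym in ya.
have [yb xy' Exy] := adjacent_swap_far fab xy xa ya xb.
have ab' : adjacent (swap f x y) a b by rewrite !pos_swap_out.
have /IH /(_ df1 ab') h : inversions (swap f x y) d < m by lia.
apply: connect_trans h; rewrite -swap_comm //.
by apply: gallery_class_swap; rewrite // Exy.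
Qed.

End Classes.

(** * Cones cut out by order relations *)

Local Open Scope classical_set_scope.
Local Open Scope ring_scope.

Section Cones.
Variables (R : realType) (n : nat).
Implicit Types (u v x y : 'cV[R]_n) (w : 'rV[R]_n) (C D E : set 'cV[R]_n).
Implicit Types (a b c : 'I_n) (Q T : {set 'I_n * 'I_n}).

Lemma mulmxD00 w u v : (w *m (u + v)) 0 0 = (w *m u) 0 0 + (w *m v) 0 0.
Proof. by rewrite mulmxDr mxE. Qed.

Lemma mulmxZ00 w (k : R) u : (w *m (k *: u)) 0 0 = k * (w *m u) 0 0.
Proof. by rewrite -scalemxAr mxE. Qed.

Lemma polyhedral_coneD C u v : polyhedral_cone C -> C u -> C v -> C (u + v).
Proof.
move=> [m [A ->]] /= Cu Cv i; rewrite mulmxDr mxE; exact: addr_ge0.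
Qed.

Lemma polyhedral_coneZ C (k : R) u : polyhedral_cone C -> 0 <= k -> C u -> C (k *: u).
Proof.
move=> [m [A ->]] /= k0 Cu i; rewrite -scalemxAr mxE; exact: mulr_ge0.
Qed.

(** Closedness: [u] is the limit of the points [u + v / N]. If a row of [A] had a negative value [s]
    at [u], the scale chosen below would make [N s + t] equal to [t - |t| - 1], which is
    negative. *)
Lemma polyhedral_cone_closed C u v : polyhedral_cone C ->
  (forall N : R, 0 < N -> C (N *: u + v)) -> C u.
Proof.
move=> [m [A ->]] /= H i; rewrite leNgt; apply/negP => lt0.
set s := (A *m u) i 0 in lt0; set t := (A *m v) i 0.
have N0 : 0 < (`|t| + 1) / - s.
  by rewrite divr_gt0 ?oppr_gt0 // ltr_wpDl // normr_ge0.
have := H _ N0 i; rewrite mulmxDr -scalemxAr mxE [X in X + _]mxE -/s -/t.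
have -> : (`|t| + 1) / - s * s = - (`|t| + 1) by rewrite invrN mulrN mulNr divfK ?lt_eqF.
rewrite leNgt => /negP; apply.
by rewrite addrC subr_lt0 ltr_pwDr // ler_norm.
Qed.

(** Far out on its ray, a point keeps its strict inequalities under a fixed perturbation. With
    [x := - y] this places [N u - y] in a cone, which bounds functionals at [y] from above. *)
Lemma dominating_scale u x : exists2 N : R, 0 < N &
  forall a b, u b 0 < u a 0 -> (N *: u + x) b 0 < (N *: u + x) a 0.
Proof.
(* Division by zero gives 0, so tied pairs add nothing to the sum of these ratios. *)
pose t (p : 'I_n * 'I_n) := `|x p.1 0 - x p.2 0| / `|u p.1 0 - u p.2 0|.
have t0 p : 0 <= t p by rewrite divr_ge0.
exists (\sum_p t p + 1) => [|a b ab]; first by rewrite ltr_wpDl // sumr_ge0.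
have ab' : 0 < u a 0 - u b 0 by rewrite subr_gt0.
have : t (a, b) < \sum_p t p + 1.
  rewrite (bigD1 (a, b)) //= -addrA ltrDl ltr_wpDl //.
  by rewrite sumr_ge0.
rewrite /t /= (gtr0_norm ab') ltr_pdivrMr // => lt.
have : x b 0 - x a 0 < (\sum_p t p + 1) * (u a 0 - u b 0).
  by apply: le_lt_trans lt; rewrite distrC ler_norm.
by rewrite !mxE mulrBr ltrBrDr addrAC ltrBlDr [x b 0 + _]addrC.
Qed.

Definition relcone Q : set 'cV[R]_n :=
  [set u | forall a b, (a, b) \in Q -> u b 0 <= u a 0].

(** Reversing a pair of [Q] turns its inequality into an equality, so faces of relation cones are
    again relation cones. *)
Definition with_ties Q T : {set 'I_n * 'I_n} :=
  (Q :|: [set p | (p.2, p.1) \in T])%SET.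

Lemma relcone_with_ties Q T u : T \subset Q -> relcone (with_ties Q T) u <->
  relcone Q u /\ (forall a b, (a, b) \in T -> u a 0 = u b 0).
Proof.
move=> /fintype.subsetP TQ; split=> [Qu|[Qu Tu] a b].
  have Qu' : relcone Q u by move=> a b ab; apply: Qu; rewrite inE ab.
  split=> // a b ab; apply/le_anti/andP; split; last exact/Qu'/TQ.
  by apply: Qu; rewrite !inE /= ab orbT.
by rewrite !inE /= => /orP[/Qu //|/Tu ->].
Qed.

Lemma polyhedral_relcone Q : polyhedral_cone (relcone Q).
Proof.
exists #|Q|, (\matrix_(i, k) ((k == (enum_val i).1)%:R - (k == (enum_val i).2)%:R)).
have E (i : 'I_#|Q|) u : ((\matrix_(i, k) ((k == (enum_val i).1)%:R -
    (k == (enum_val i).2)%:R)) *m u) i 0 = u (enum_val i).1 0 - u (enum_val i).2 0.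
  rewrite mxE; under eq_bigr => k _ do rewrite mxE mulrBl !mulr_natl !mulrb.
  by rewrite sumrB -!big_mkcond !big_pred1_eq.
apply/seteqP; split=> u /= Qu => [i|a b ab].
  by rewrite E subr_ge0; apply: Qu; rewrite -surjective_pairing enum_valP.
by have := Qu (enum_rank_in ab (a, b)); rewrite E subr_ge0 enum_rankK_in.
Qed.

(** The supporting functional is the sum of [u a - u b] over [T]; its terms are nonnegative on the
    cone, so it vanishes only where all of them do. *)
Lemma relcone_face Q T : T \subset Q -> face_of (relcone (with_ties Q T)) (relcone Q).
Proof.
move=> TQ; exists (\row_k \sum_(p in T) ((k == p.1)%:R - (k == p.2)%:R)).
have E u : ((\row_k \sum_(p in T) ((k == p.1)%:R - (k == p.2)%:R)) *m u) 0 0 =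
    \sum_(p in T) (u p.1 0 - u p.2 0).
  rewrite mxE; under eq_bigr => k _ do rewrite mxE mulr_suml.
  rewrite exchange_big /=; apply: eq_bigr => p _.
  under eq_bigr => k _ do rewrite mulrBl !mulr_natl !mulrb.
  by rewrite sumrB -!big_mkcond !big_pred1_eq.
have pos u : relcone Q u -> forall p, p \in T -> 0 <= u p.1 0 - u p.2 0.
  move=> Qu p pT; rewrite subr_ge0; apply: Qu.
  by rewrite -surjective_pairing (fintype.subsetP TQ).
split=> [u Qu|]; first by rewrite E sumr_ge0 //; exact: pos.
apply/seteqP; split=> u; rewrite (relcone_with_ties _ TQ) /= E => -[Qu Tu].
  by split=> //; rewrite big1 // => -[a b] /Tu /= ->; rewrite subrr.
split=> // a b ab; apply/eqP; rewrite -subr_eq0.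
have /eqP := Tu; rewrite psumr_eq0; last exact: pos.
by move=> /allP /(_ (a, b) (mem_index_enum _)); rewrite ab.
Qed.

(** For each pair that is not tied on all of [E], pick a point of [E] that separates it. In the sum
    of these points no difference cancels, since all are nonnegative on [Q]. *)
Lemma generic_point Q E : E `<=` relcone Q -> E 0 ->
    (forall u v, E u -> E v -> E (u + v)) ->
  exists2 x, E x & forall a b, (a, b) \in Q -> x a 0 = x b 0 ->
    forall u, E u -> u a 0 = u b 0.
Proof.
move=> EQ E0 ED.
have wit (p : 'I_n * 'I_n) : exists x, E x /\
    (x p.1 0 = x p.2 0 -> forall u, E u -> u p.1 0 = u p.2 0).
  have [all|no] := pselect (forall u, E u -> u p.1 0 = u p.2 0); first by exists 0.
  apply: contrapT => noE; apply: no => u Eu; apply: contrapT => ne; apply: noE.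
  by exists u; split=> // /ne.
have [X XP] := boolp.choice wit; have XE p : E (X p) by case: (XP p).
exists (\sum_p X p); first exact: (big_ind E).
move=> a b ab tie; apply: (XP (a, b)).2 => /=.
have : \sum_p (X p a 0 - X p b 0) = 0.
  by rewrite sumrB -!summxE tie subrr.
move=> /eqP; rewrite psumr_eq0 => [|p _]; last first.
  by rewrite subr_ge0; exact: (EQ _ (XE p)).
by move=> /allP /(_ (a, b) (mem_index_enum _)) /=; rewrite subr_eq0 => /eqP.
Qed.

(** A test for faces without a functional: the ties of a generic point of [E] serve as [T], and the
    last hypothesis puts the whole face with these ties into [E]. *)
Lemma facialP Q E : E `<=` relcone Q -> E 0 ->
    (forall u v, E u -> E v -> E (u + v)) ->
    (forall x y, E x -> relcone Q y ->
      (forall a b, (a, b) \in Q -> x a 0 = x b 0 -> y a 0 = y b 0) -> E y) ->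
  exists2 T : {set 'I_n * 'I_n}, T \subset Q & E = relcone (with_ties Q T).
Proof.
move=> EQ E0 ED Eface; have [x Ex xgen] := generic_point EQ E0 ED.
exists [set p in Q | x p.1 0 == x p.2 0]%SET.
  by apply/fintype.subsetP => p; rewrite inE => /andP[].
have TQ : [set p in Q | x p.1 0 == x p.2 0]%SET \subset Q.
  by apply/fintype.subsetP => p; rewrite inE => /andP[].
apply/seteqP; split=> u; rewrite (relcone_with_ties _ TQ).
  move=> Eu; split=> [|a b]; first exact: EQ.
  by rewrite inE /= => /andP[ab /eqP xab]; apply: xgen ab xab _ Eu.
move=> [Qu Tu]; apply: Eface Ex Qu _ => a b ab xab.
by apply: Tu; rewrite inE ab /= xab.
Qed.

Lemma face_of_relcone Q D : face_of D (relcone Q) ->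
  exists2 T : {set 'I_n * 'I_n}, T \subset Q & D = relcone (with_ties Q T).
Proof.
move=> [w [w0 ->]]; have pc := polyhedral_relcone Q; apply: facialP.
- by move=> u [].
- by split=> [a b|]; rewrite ?mulmx0 !mxE.
- move=> u v [Qu wu] [Qv wv]; split.
    exact: (polyhedral_coneD pc).
  by rewrite mulmxD00 wu wv addr0.
- move=> x y [Qx wx] Qy tie; split=> //; apply/le_anti; rewrite w0 // andbT.
  (* As [w] vanishes at [x], its value at the point [N x - y] of the cone is minus its value at
     [y]. *)
  have [N N0 dom] := dominating_scale x (- y).
  have : relcone Q (N *: x + - y).
    move=> a b ab; have := Qx a b ab; rewrite le_eqVlt => /predU1P[E|/dom/ltW //].
    by rewrite !mxE E (tie a b).
  by move=> /w0; rewrite mulmxD00 mulmxZ00 wx mulr0 add0r mulmxN mxE oppr_ge0.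
Qed.

Lemma face_of_trans Q D E : face_of D (relcone Q) -> face_of E D -> face_of E (relcone Q).
Proof.
move=> /face_of_relcone[T TQ ->] /face_of_relcone[T' T'Q ->].
(* A pair of [T'] outside [Q] is the reversal of a pair of [T], which is tied already. *)
have TQ' : (T :|: (T' :&: Q))%SET \subset Q.
  by rewrite finset.subUset TQ finset.subsetIr.
suff -> : relcone (with_ties (with_ties Q T) T') =
    relcone (with_ties Q (T :|: (T' :&: Q))%SET) by exact: relcone_face.
apply/seteqP; split=> u.
all: rewrite (relcone_with_ties _ T'Q) (relcone_with_ties _ TQ) (relcone_with_ties _ TQ').
  move=> [[Qu Tu] T'u]; split=> // a b; rewrite !inE => /orP[/Tu //|/andP[/T'u //]].
move=> [Qu Tu]; split; first by split=> // a b ab; apply: Tu; rewrite inE ab.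
move=> a b ab; have := fintype.subsetP T'Q _ ab; rewrite !inE /= => /orP[abQ|ba].
  by apply: Tu; rewrite !inE ab abQ orbT.
by rewrite (Tu b a) // inE ba.
Qed.

End Cones.

(** * Chambers and integer test points *)

Section Chambers.
Variables (R : realType) (n : nat).
Implicit Types (u v x y : 'cV[R]_n) (d e : 'S_n) (a b c : 'I_n).
Implicit Types (K : {set 'I_n}).

Lemma Sn_coneP d u :
  Sn_cone d u <-> forall a b, (pos d a < pos d b)%N -> u b 0 <= u a 0.
Proof.
split=> [du a b ab|du i j].
  have := du ((d^-1)%g a) ((d^-1)%g b) (ltnW ab); by rewrite !permKV.
rewrite leq_eqVlt => /predU1P[/val_inj -> //|ij].
by apply: du; rewrite !pos_perm.
Qed.

Lemma Sn_cone_swap d a b u : adjacent d a b -> u a 0 = u b 0 ->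
  Sn_cone d u -> Sn_cone (swap d a b) u.
Proof.
move=> ab uab /Sn_coneP du; apply/Sn_coneP => x y; rewrite !pos_swap.
have [->|xa] := eqVneq x a; have [->|ya] := eqVneq y a => //.
- have [->|yb] := eqVneq y b; first by rewrite uab.
  by rewrite uab; apply: du.
- have [->|xb] := eqVneq x b; first by rewrite uab.
  by rewrite uab; apply: du.
- have [->|xb] := eqVneq x b; have [->|yb] := eqVneq y b => //.
  + by rewrite -uab; apply: du.
  + by rewrite -uab; apply: du.
  + exact: du.
Qed.

(** Integer test points reduce membership in a chamber to arithmetic of positions. *)
Definition nat_vec (h : 'I_n -> nat) : 'cV[R]_n := \col_i (h i)%:R.

Definition height d c : nat := (n - pos d c)%N.

Lemma nat_vec_Sn_cone d (h : 'I_n -> nat) :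
  (forall a b, (pos d a < pos d b)%N -> (h b <= h a)%N) -> Sn_cone d (nat_vec h).
Proof. by move=> H; apply/Sn_coneP => a b /H; rewrite !mxE ler_nat. Qed.

Lemma height_Sn_cone d : Sn_cone d (nat_vec (height d)).
Proof. by apply: nat_vec_Sn_cone => a b; rewrite /height; lia. Qed.

Lemma nat_vecD (h h' : 'I_n -> nat) :
  nat_vec h + nat_vec h' = nat_vec (fun c => h c + h' c)%N.
Proof. by apply/matrixP => i k; rewrite !mxE natrD. Qed.

Lemma nat_vecZ k (h : 'I_n -> nat) : k%:R *: nat_vec h = nat_vec (fun c => k * h c)%N.
Proof. by apply/matrixP => i l; rewrite !mxE natrM. Qed.

Lemma exists_sorted (h : 'I_n -> nat) :
  exists d, forall a b, (h b < h a)%N -> (pos d a < pos d b)%N.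
Proof.
by have [d dE] := lex_sort h 1%g; exists d => a b ba; rewrite dE ltEnat /= ba.
Qed.

Lemma adjacent_of_sorted (h : 'I_n -> nat) d a b :
  (forall a b, (h b < h a)%N -> (pos d a < pos d b)%N) -> (h b < h a)%N ->
  (forall c, c != a -> c != b -> (h c < h b)%N || (h a < h c)%N) -> adjacent d a b.
Proof.
move=> dh ba gap; apply: adjacent_of_none_between => [|c ac cb]; first exact: dh.
have /gap : c != a by apply/(@ord_neq_of_pos _ d); lia.
have cb' : c != b by apply/(@ord_neq_of_pos _ d); lia.
by move=> /(_ cb') /orP[] /dh; lia.
Qed.

(** Adding the same point with [i] and [j] exchanged gives a point common to all walls with label
    [CI i j K]. *)
Definition wall_height i j K c : nat :=
  if c \in K then 3 else if c == i then 2 else if c == j then 1 else 0.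

Lemma exists_wall i j K : i != j -> K \subset (~: [set i; j])%SET ->
  exists d, adjacent d i j /\ before_set d i = K.
Proof.
move=> ij /fintype.subsetP KC.
have iK : i \notin K by apply/negP => /KC; rewrite !inE eqxx.
have jK : j \notin K by apply/negP => /KC; rewrite !inE eqxx orbT.
pose h := wall_height i j K; have [d dh] := exists_sorted h; exists d.
have hi : h i = 2%N by rewrite /h /wall_height (negPf iK) eqxx.
have hj : h j = 1%N by rewrite /h /wall_height (negPf jK) eq_sym (negPf ij) eqxx.
split.
  apply: (adjacent_of_sorted dh) => [|c /negPf ci /negPf cj]; rewrite hi hj //.
  by rewrite /h /wall_height ci cj; case: ifP.
apply/setP => c; rewrite inE; apply/idP/idP => [ci|cK]; last first.
  by apply: dh; rewrite hi /h /wall_height cK.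
apply/negPn/negP => cK; have : c != i by apply/(@ord_neq_of_pos _ d); lia.
move=> /negPf c_i; suff /dh : (h c < h i)%N by lia.
by rewrite hi /h /wall_height (negPf cK) c_i; case: ifP.
Qed.

Lemma removed_CI_equivalence (r : rel 'S_n) t : equivalence_rel r ->
  removed_CI (equivalence_partition r [set: 'S_n]%SET) t <->
  exists d a b, [/\ adjacent d a b, r d (swap d a b) & t = wall_CI d a b].
Proof.
move=> req; have blockE d e :
    (e \in finset.pblock (equivalence_partition r [set: 'S_n]%SET) d) = r d e.
  by rewrite pblock_equivalence_partition // => x y z _ _ _; apply: req.
have KE d (k : 'I_n) : [set d i | i : 'I_n & (i < k)%N]%SET = before_set d (d k).
  apply/setP => c; rewrite inE pos_perm; apply/imsetP/idP => [[i + ->]|ck].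
    by rewrite inE pos_perm.
  by exists ((d^-1)%g c); rewrite ?permKV // inE.
split=> [[d [d' [k [k' [[kk' dk dk' out] dd' ->]]]]]|[d [a [b [ab dd' ->]]]]].
  exists d, (d k), (d k'); split; first by rewrite !pos_perm.
    rewrite blockE in dd'; congr (r d _) : dd'; apply/permP => i; rewrite permM.
    have [->|ik] := eqVneq i k; first by rewrite tpermL dk'.
    have [->|ik'] := eqVneq i k'; first by rewrite tpermR dk.
    by rewrite tpermD ?(inj_eq (@perm_inj _ d)) 1?eq_sym ?out.
  by rewrite /wall_label KE.
exists d, (swap d a b), ((d^-1)%g a), ((d^-1)%g b); split.
- split; rewrite ?permM ?permKV ?tpermL ?tpermR // => i ia ib.
  rewrite permM tpermD //; [move: ia|move: ib]; apply: contraNneq => ->.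
    by rewrite permK.
  by rewrite permK.
- by rewrite blockE.
- by rewrite /wall_label KE !permKV.
Qed.

End Chambers.

(** * The fan of a semigraphoid *)

Section FanOfSemigraphoid.
Variables (R : realType) (n : nat) (M : set (CI_type n)).
Hypothesis sgM : semigraphoid M.
Implicit Types (u v x y : 'cV[R]_n) (d e : 'S_n) (a b c : 'I_n).

Definition class_cone d : set 'cV[R]_n := relcone (class_order M d).

Lemma class_cone_eq d e : gallery_class M d e -> class_cone d = class_cone e.
Proof. by move=> de; rewrite /class_cone (class_order_eq de). Qed.

Lemma Sn_cone_class_cone d e : gallery_class M d e -> Sn_cone e `<=` class_cone d.
Proof.
by move=> de u /Sn_coneP eu a b /class_orderP ab; apply: eu; apply: ab.
Qed.

Lemma gallery_class_Sn_cone d e : Sn_cone e `<=` class_cone d -> gallery_class M d e.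
Proof.
move=> sub; apply: (linear_extension sgM) => a b ab.
have := sub _ (height_Sn_cone R e) a b ab; rewrite !mxE ler_nat /height.
have /(@pos_neq _ e) : a != b.
  by move/class_orderP: ab => /(_ d (connect0 _ _)) ab; apply/(@ord_neq_of_pos _ d); lia.
by have := pos_lt e a; have := pos_lt e b; lia.
Qed.

(** A class cone is the union of its chambers: sorting by [y], with ties as in [d], extends the
    class order. As ties follow [d], neighbours in [d] that are tied in [y] stay neighbours. *)
Lemma class_cone_chamber d y : class_cone d y ->
  exists e, [/\ gallery_class M d e, Sn_cone e y &
    forall a b, adjacent d a b -> y a 0 = y b 0 -> adjacent e a b].
Proof.
move=> dy; have [e eE] := lex_sort (fun i => y i 0) d; exists e; split.
- apply: (linear_extension sgM) => a b ab; rewrite eE.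
  have := dy a b ab; rewrite le_eqVlt => /predU1P[->|-> //].
  by move/class_orderP: ab => /(_ d (connect0 _ _)) ->; rewrite eqxx orbT.
- by apply/Sn_coneP => a b; rewrite eE => /orP[/ltW //|/andP[/eqP -> _]].
- move=> a b ab yab; apply: adjacent_of_none_between => [|c].
    by rewrite eE yab eqxx ab ltnS leqnn orbT.
  rewrite !eE yab => /orP[bc|/andP[/eqP <- ac]].
    by rewrite lt_gtF //= eq_sym (gt_eqF bc).
  by rewrite ltxx eqxx /=; lia.
Qed.

Lemma class_cone_facet d a b y : adjacent d a b -> class_cone d y ->
  y a 0 = y b 0 -> class_cone (swap d a b) y.
Proof.
move=> ab dy yab; have [e [de ey adj]] := class_cone_chamber dy.
have eab := adj _ _ ab yab.
have := gallery_class_swap_facet sgM ab de eab; rewrite gallery_class_sym => dse.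
exact: (Sn_cone_class_cone dse) (Sn_cone_swap eab yab ey).
Qed.

(* Induction along a geodesic from [d] to [e]: all its chambers contain [x], so
   each wall that separates two classes lies in a hyperplane containing [y]. *)
Lemma class_cone_exchange d e x y : Sn_cone d x -> Sn_cone e x -> class_cone d y ->
    (forall a b, (a, b) \in class_order M d -> x a 0 = x b 0 -> y a 0 = y b 0) ->
  class_cone e y.
Proof.
have [m] := ubnP (inversions d e); elim: m d => // m IH d lt_m dx ex dy tie.
have [<- //|/eqP de] := eqVneq d e.
have [a [b [ab ba]]] := adjacent_inversion de.
have i1 := inversions_swap ab ba.
have xab : x a 0 = x b 0.
  apply/le_anti/andP; split; first by move/Sn_coneP: ex; apply.
  by move/Sn_coneP: dx; apply; rewrite ab.
have sx := Sn_cone_swap ab xab dx.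
have lt_m' : (inversions (swap d a b) e < m)%N by lia.
have [Mab|nMab] := pselect (M (wall_CI d a b)).
  have dsd := gallery_class_swap ab Mab.
  apply: IH lt_m' sx ex _ _; first by rewrite -(class_cone_eq dsd).
  by move=> c c'; rewrite -(class_order_eq dsd); apply: tie.
have yab : y a 0 = y b 0.
  apply: tie xab; apply/class_orderP => f df; rewrite ltnNge leq_eqVlt.
  apply/norP; split; first by apply/eqP => /pos_inj E; move: ab; rewrite E; lia.
  by apply/negP => fba; apply: nMab; apply: (wall_CI_removed sgM df).
have sy := class_cone_facet ab dy yab.
apply: (IH _ lt_m' sx ex sy) => c c' cc' xcc'.
apply/le_anti/andP; split; last exact: sy.
(* The reverse inequality: [N x - y] also lies in the cone of [d] and on the hyperplane of the wall,
   so it passes to the neighbouring cone, where the tie of [x] leaves only [- y]. *)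
have [N N0 dom] := dominating_scale x (- y).
have dz : class_cone d (N *: x + - y).
  move=> p q pq; have : x q 0 <= x p 0.
    by move/Sn_coneP: dx; apply; move/class_orderP: pq; apply; apply: connect0.
  by rewrite le_eqVlt => /predU1P[E|/dom/ltW //]; rewrite !mxE E (tie p q).
have zab : (N *: x + - y) a 0 = (N *: x + - y) b 0 by rewrite !mxE xab yab.
by have := class_cone_facet ab dz zab cc'; rewrite !mxE xcc' lerD2l lerN2.
Qed.

Definition class_fan : set (set 'cV[R]_n) :=
  [set D | exists d, face_of D (class_cone d)].

(** A common point [x] lies in a chamber of each class, and [class_cone_exchange] carries every [y]
    of the smallest face around [x] from one cone to the other. *)
Lemma class_coneI_face d e : face_of (class_cone d `&` class_cone e) (class_cone d).
Proof.
have [|||| T TQ ->] := @facialP R n (class_order M d) (class_cone d `&` class_cone e).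
- by move=> u [].
- by split=> a b _; rewrite !mxE.
- move=> u v [du eu] [dv ev].
  by split; apply: (polyhedral_coneD (polyhedral_relcone _ _)).
- move=> x y [dx ex] dy tie; split=> //.
  have [d' [dd' d'x _]] := class_cone_chamber dx.
  have [e' [ee' e'x _]] := class_cone_chamber ex.
  rewrite (class_cone_eq ee'); apply: (class_cone_exchange d'x e'x).
    by rewrite -(class_cone_eq dd').
  by rewrite -(class_order_eq dd').
- exact: relcone_face.
Qed.

Lemma face_of_refl (C : set 'cV[R]_n) : face_of C C.
Proof.
exists 0; split=> [u _|]; first by rewrite mul0mx mxE.
by apply/seteqP; split=> [u Cu|u []//]; rewrite /= mul0mx mxE.
Qed.

Lemma class_fan_is_fan : is_fan class_fan.
Proof.
split.
- apply: (@sub_finite_set _ _ (range (@relcone R n))).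
    by move=> D [d /face_of_relcone[T _ ->]]; exists (with_ties (class_order M d) T).
  exact/finite_image/finite_finset.
- by move=> D [d /face_of_relcone[T _ ->]]; apply: polyhedral_relcone.
- by move=> C D [d dC] CD; exists d; apply: face_of_trans dC CD.
- suff S C D : class_fan C -> class_fan D -> face_of (C `&` D) C.
    by move=> C D FC FD; split; [exact: S | rewrite setIC; exact: S].
  move=> [d [w1 [w10 ->]]] [e [w2 [w20 ->]]].
  (* Intersected with the face of the second cone, the first cone yields a face of a face, so some
     functional [v] cuts it out; [v] is then restricted to the face of the first cone. *)
  have [v [v0 vE]] : face_of (class_cone d `&` [set u | class_cone e u /\ (w2 *m u) 0 0 = 0])
      (class_cone d).
    apply: face_of_trans (class_coneI_face d e) _; exists w2; split=> [u [_ /w20 //]|].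
    by apply/seteqP; split=> [u [du [eu wu]]|u [[du eu] wu]].
  exists v; split=> [u [/v0 //]|]; apply/seteqP; split=> u.
    move=> [[du w1u] eu]; split=> //.
    by have [] : [set u | class_cone d u /\ (v *m u) 0 0 = 0] u by rewrite -vE.
  move=> [[du w1u] vu]; split=> //.
  by have [] : (class_cone d `&` [set u | class_cone e u /\ (w2 *m u) 0 0 = 0]) u
    by rewrite vE.
Qed.

Lemma class_fan_coarsening : Sn_coarsening class_fan.
Proof.
split=> [|u]; first exact: class_fan_is_fan.
have [e eE] := lex_sort (fun i => u i 0) 1%g.
exists (class_cone e); split; first by exists e; apply: face_of_refl.
move=> v /= uv; apply: (@Sn_cone_class_cone e e); first exact: connect0.
apply/Sn_coneP => a b; rewrite eE => /orP[/(uv b a).1.1/ltW //|/andP[/eqP/(uv a b).2.1 ->]].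
by rewrite lexx.
Qed.

Lemma class_cone_maximal d : maximal_cone class_fan (class_cone d).
Proof.
split=> [|D [e [w [w0 ->]]] sub]; first by exists d; apply: face_of_refl.
apply/seteqP; split=> // u [eu _].
suff -> : class_cone d = class_cone e by [].
apply/esym/class_cone_eq/gallery_class_Sn_cone => v dv.
by case: (sub v (Sn_cone_class_cone (connect0 _ _) dv)).
Qed.

Lemma same_maximal_cone_class_fan d e :
  same_maximal_cone class_fan d e <-> gallery_class M d e.
Proof.
split=> [[C [[[f [w [_ CE]]] _] dC eC]]|de]; last first.
  exists (class_cone d); split; first exact: class_cone_maximal.
    exact/Sn_cone_class_cone/connect0.
  exact: Sn_cone_class_cone.
have sub : C `<=` class_cone f by rewrite CE => u [].
apply: (@connect_trans _ _ f); last first.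
  exact: gallery_class_Sn_cone (subset_trans eC sub).
have := gallery_class_Sn_cone (subset_trans dC sub).
by rewrite gallery_class_sym.
Qed.

(** A wall inside a class has its label in [M] by convexity; conversely every statement of [M]
    labels some wall, and crossing it stays in the class. *)
Lemma removed_CI_class_fan : removed_CI (fan_partition class_fan) = M.
Proof.
have pE : fan_partition class_fan =
    equivalence_partition (gallery_class M) [set: 'S_n]%SET.
  rewrite /fan_partition; congr equivalence_partition.
  apply/funext => d; apply/funext => e.
  by apply/asboolP/idP => /same_maximal_cone_class_fan.
have req : equivalence_rel (gallery_class M).
  move=> d e f; split=> [|de]; first exact: connect0.
  by apply/idP/idP; apply: connect_trans; rewrite // -/(gallery_class M) gallery_class_sym.
apply/seteqP; split=> t; rewrite pE removed_CI_equivalence //.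
  move=> [d [a [b [ab dd' ->]]]]; apply: (wall_CI_removed sgM dd' ab).
  by rewrite pos_swapl pos_swapr ab.
move=> Mt; have [i [j [K [ij KC tE]]]] := sgM.1 _ Mt.
have [d [dij dK]] := exists_wall ij KC.
have tE' : t = wall_CI d i j by rewrite /wall_CI dK.
by exists d, i, j; split=> //; apply: gallery_class_swap; rewrite // -tE'.
Qed.

End FanOfSemigraphoid.

(** * Coarsenings of the S_n-fan *)

Section Coarsening.
Variables (R : realType) (n : nat) (F : set (set 'cV[R]_n)).
Hypothesis coarseF : Sn_coarsening F.
Implicit Types (u v : 'cV[R]_n) (d e f : 'S_n) (a b c i j l x y : 'I_n).
Implicit Types (K : {set 'I_n}) (C D : set 'cV[R]_n).

(** The open cone of [d], that is, the interior of its chamber. *)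
Definition strictly_sorted d u :=
  forall a b, (pos d a < pos d b)%N -> u b 0 < u a 0.

Lemma strictly_sorted_Sn_cone d u : strictly_sorted d u -> Sn_cone d u.
Proof. by move=> du; apply/Sn_coneP => a b /du /ltW. Qed.

Lemma nat_vec_strictly_sorted d (h : 'I_n -> nat) :
  (forall a b, (pos d a < pos d b)%N -> (h b < h a)%N) ->
  strictly_sorted d (nat_vec R h).
Proof. by move=> H a b /H; rewrite !mxE ltr_nat. Qed.

Lemma height_strictly_sorted d : strictly_sorted d (nat_vec R (height d)).
Proof.
apply: nat_vec_strictly_sorted => a b; rewrite /height.
by have := pos_lt d a; have := pos_lt d b; lia.
Qed.

Lemma strictly_sorted_equiv d u v :
  strictly_sorted d u -> strictly_sorted d v -> perm_equiv u v.
Proof.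
move=> du dv i j; case: (ltngtP (pos d i) (pos d j)) => [ij|ji|/pos_inj ->].
- have ui := du _ _ ij; have vi := dv _ _ ij; split; split.
  + by rewrite lt_gtF.
  + by rewrite lt_gtF.
  + by move=> E; rewrite E ltxx in ui.
  + by move=> E; rewrite E ltxx in vi.
- have ui := du _ _ ji; have vi := dv _ _ ji; split; split => //.
  + by move=> E; rewrite E ltxx in ui.
  + by move=> E; rewrite E ltxx in vi.
- by rewrite !ltxx.
Qed.

Let polyF C : F C -> polyhedral_cone C.
Proof. by case: coarseF => -[_ + _ _] _; apply. Qed.

(* Faces are extreme: the face [C `&` D] of [C] contains [u] and [v] as soon as
   it contains [u + v]. *)
Lemma fan_extreme C D u v : F C -> F D -> C u -> C v -> D (u + v) -> D v.
Proof.
move=> FC FD Cu Cv Duv; case: coarseF => -[_ _ _ FI] _.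
have [[w [w0 E]] _] := FI _ _ FC FD.
have Cuv : C (u + v) by apply: polyhedral_coneD (polyF FC) Cu Cv.
have : [set x | C x /\ (w *m x) 0 0 = 0] (u + v) by rewrite -E.
move=> [_]; rewrite mulmxD00 => /eqP; rewrite paddr_eq0 ?w0 // => /andP[_ /eqP wv].
by have [] : (C `&` D) v by rewrite E.
Qed.

(** The coarsening provides a cone around the open chamber; as this cone is closed, it contains the
    boundary too. *)
Lemma chamber_in_fan d : exists2 C, F C & Sn_cone d `<=` C.
Proof.
have [C [FC hC]] := coarseF.2 (nat_vec R (height d)); exists C => // u du.
apply: (polyhedral_cone_closed (v := nat_vec R (height d)) (polyF FC)) => N N0.
apply: hC => /=; apply: (strictly_sorted_equiv (@height_strictly_sorted d)) => a b ab.
have := height_strictly_sorted ab; rewrite !mxE => hab; apply: ler_ltD hab.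
by rewrite ler_pM2l //; move/Sn_coneP: du; apply.
Qed.

(** A functional that is nonnegative on [C] and vanishes at the interior point [u] vanishes on all
    of [C], so the face [C] meets [D] in is [C] itself. *)
Lemma fan_subset_of_interior C D d u : F C -> F D -> Sn_cone d `<=` C ->
  strictly_sorted d u -> D u -> C `<=` D.
Proof.
move=> FC FD dC du Du v Cv; case: coarseF => -[_ _ _ FI] _.
have [[w [w0 E]] _] := FI _ _ FC FD.
have Cu : C u by apply/dC/strictly_sorted_Sn_cone.
have [_ wu] : [set u | C u /\ (w *m u) 0 0 = 0] u by rewrite -E.
suff wv : (w *m v) 0 0 = 0 by have [] : (C `&` D) v by rewrite E.
apply/le_anti/andP; split; last exact: w0.
have [N N0 dom] := dominating_scale u (- v).
have Nuv : C (N *: u + - v).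
  by apply/dC/strictly_sorted_Sn_cone => a b ab; apply/dom/du.
by have := w0 _ Nuv; rewrite mulmxD00 mulmxZ00 wu mulr0 add0r mulmxN mxE oppr_ge0.
Qed.

Lemma Sn_cone_subset D d u : F D -> strictly_sorted d u -> D u -> Sn_cone d `<=` D.
Proof.
move=> FD du Du; have [C FC dC] := chamber_in_fan d.
exact: subset_trans dC (fan_subset_of_interior FC FD dC du Du).
Qed.

(** Any cone of the fan that contains a chamber is maximal, by [fan_subset_of_interior]. *)
Lemma same_maximal_coneP d e : same_maximal_cone F d e <->
  exists C, [/\ F C, Sn_cone d `<=` C & Sn_cone e `<=` C].
Proof.
split=> [[C [[FC _] dC eC]]|[C [FC dC eC]]]; exists C; split=> //; split=> // D FD CD.
apply/seteqP; split=> //.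
have dD := subset_trans dC CD; have hd := @height_strictly_sorted d.
exact: (fan_subset_of_interior FD FC dD hd) (dC _ (strictly_sorted_Sn_cone hd)).
Qed.

Definition same_cone : rel 'S_n := fun d e => `[< same_maximal_cone F d e >].

Lemma same_coneP d e : reflect
  (exists C, [/\ F C, Sn_cone d `<=` C & Sn_cone e `<=` C]) (same_cone d e).
Proof. by apply: (iffP (asboolP _)) => /same_maximal_coneP. Qed.

Lemma same_cone_refl : reflexive same_cone.
Proof. by move=> d; apply/same_coneP; have [C FC dC] := chamber_in_fan d; exists C. Qed.

Lemma same_cone_sym : symmetric same_cone.
Proof. by move=> d e; apply/same_coneP/same_coneP => -[C [? ? ?]]; exists C. Qed.

Lemma same_cone_trans : transitive same_cone.
Proof.
move=> e d f /same_coneP[C [FC dC eC]] /same_coneP[D [FD eD fD]]; apply/same_coneP.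
exists C; split=> //; apply: subset_trans fD _; have he := @height_strictly_sorted e.
exact: (fan_subset_of_interior FD FC eD he) (eC _ (strictly_sorted_Sn_cone he)).
Qed.

Lemma same_cone_equivalence : equivalence_rel same_cone.
Proof.
move=> d e f; split=> [|de]; first exact: same_cone_refl.
by apply/idP/idP; apply: same_cone_trans; rewrite // same_cone_sym.
Qed.

Lemma removed_CIP t : removed_CI (fan_partition F) t <->
  exists d a b, [/\ adjacent d a b, same_cone d (swap d a b) & t = wall_CI d a b].
Proof. exact: (removed_CI_equivalence _ same_cone_equivalence). Qed.

Lemma wall_height_Sn_cone d i j : adjacent d i j ->
  Sn_cone d (nat_vec R (wall_height i j (before_set d i))).
Proof.
move=> ij; apply: nat_vec_Sn_cone => a b ab; rewrite /wall_height !inE !(eq_pos d).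
by do ?[case: ifP => ?]; lia.
Qed.

(** The two test points of the label lie in [C] and their sum lies in [e], hence in [D]; by
    extremality [D] contains the one beyond the wall of [e]. *)
Lemma same_cone_wall d e i j :
  adjacent d i j -> adjacent e i j -> before_set e i = before_set d i ->
  same_cone d (swap d i j) -> same_cone e (swap e i j).
Proof.
move=> dij eij edK /same_coneP[C [FC dC sC]].
have [D FD eD] := chamber_in_fan e; apply/same_coneP; exists D; split=> //.
pose K := before_set e i.
have Cy : C (nat_vec R (wall_height i j K)).
  by apply: dC; rewrite /K edK; apply: wall_height_Sn_cone.
have Cz : C (nat_vec R (wall_height j i K)).
  apply: sC; rewrite /K edK -(before_set_swapr dij).
  exact/wall_height_Sn_cone/adjacent_swap.
have Dz : D (nat_vec R (wall_height j i K)).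
  apply: (fan_extreme FC FD Cy Cz); apply: eD; rewrite nat_vecD.
  apply: nat_vec_Sn_cone => a b ab; rewrite /wall_height /K !inE !(eq_pos e).
  by do ?[case: ifP => ?]; lia.
(* A relative interior point of the wall of [e]; adding the test point pushes it into the interior
   of the next chamber. *)
have Dh : D (nat_vec R (fun c => height e c + height (swap e i j) c)%N).
  apply/eD/nat_vec_Sn_cone => a b ab; rewrite /height !pos_swap !(eq_pos e).
  by do ?[case: ifP => ?]; lia.
apply: (Sn_cone_subset FD _ (polyhedral_coneD (polyF FD) Dh Dz)).
rewrite nat_vecD; apply: nat_vec_strictly_sorted => a b.
have := pos_lt e a; have := pos_lt e b; have := pos_lt e j.
rewrite /height /wall_height /K !inE !pos_swap !(eq_pos e).
by do ?[case: ifP => ?]; lia.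
Qed.

Lemma removed_CI_wall e i j : adjacent e i j ->
  removed_CI (fan_partition F) (wall_CI e i j) -> same_cone e (swap e i j).
Proof.
move=> eij /removed_CIP[d [a [b [ab dd' E]]]].
have [edK [[ai bj]|[aj bi]]] := CI_inj (adjacent_neq eij) E; subst a b.
  exact: same_cone_wall ab eij _ dd'.
apply: (same_cone_wall (adjacent_swap ab) eij).
  by rewrite before_set_swapr.
by rewrite swapK same_cone_sym.
Qed.

Lemma exists_hexagon i j l K : uniq [:: i; j; l] -> K \subset (~: [set i; j; l])%SET ->
  exists d, [/\ adjacent d l i, adjacent d i j & before_set d l = K].
Proof.
rewrite /= !inE negb_or andbT => /andP[/andP[ij il] jl] /fintype.subsetP KC.
have iK : i \notin K by apply/negP => /KC; rewrite !inE eqxx.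
have jK : j \notin K by apply/negP => /KC; rewrite !inE eqxx orbT.
have lK : l \notin K by apply/negP => /KC; rewrite !inE eqxx orbT.
pose h c : nat := if c \in K then 4 else if c == l then 3 else
  if c == i then 2 else if c == j then 1 else 0.
have [d dh] := exists_sorted h; exists d.
have hl : h l = 3%N by rewrite /h (negPf lK) eqxx.
have hi : h i = 2%N by rewrite /h (negPf iK) (negPf il) eqxx.
have hj : h j = 1%N.
  by rewrite /h (negPf jK) (negPf jl) eq_sym (negPf ij) eqxx.
split.
- apply: (adjacent_of_sorted dh) => [|c /negPf cl /negPf ci]; rewrite ?hl hi //.
  by rewrite /h cl ci; do ?case: ifP.
- apply: (adjacent_of_sorted dh) => [|c /negPf ci /negPf cj]; rewrite hi hj //.
  by rewrite /h ci cj; do ?case: ifP.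
- apply/setP => c; rewrite inE; apply/idP/idP => [cl|cK]; last first.
    by apply: dh; rewrite hl /h cK.
  apply/negPn/negP => cK; have : c != l by apply/(@ord_neq_of_pos _ d); lia.
  move=> /negPf c_l; suff /dh : (h c < h l)%N by lia.
  by rewrite hl /h (negPf cK) c_l; do ?case: ifP.
Qed.

(* Adding a multiple of the second summand to twice the heights of [e] lifts [b]
   past [a] (factor 3) and then also past [c] (factor 5). *)
Lemma lifted_heights e a b c : adjacent e c a -> adjacent e a b ->
  let h k x := (2 * height e x + k * (if pos e x < pos e c then 2 else x == b))%N in
  (forall x y, (pos (swap e a b) x < pos (swap e a b) y)%N -> (h 3 y < h 3 x)%N) /\
  (forall x y, (pos (swap (swap e a b) b c) x < pos (swap (swap e a b) b c) y)%N ->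
     (h 5 y < h 5 x)%N).
Proof.
move=> ca ab h; split=> x y.
all: have := pos_lt e x; have := pos_lt e y; have := pos_lt e b.
all: rewrite /h /height !pos_swap !(eq_pos e).
all: move: (pos e x) (pos e y) (pos e a) (pos e b) (pos e c) ca ab.
all: move=> {h} px py pa pb pc -> ->.
all: by do ?[case: ifP => ?; try (exfalso; lia)]; lia.
Qed.

(** The cone [C] contains the chambers [a c b] and [b a c], hence the points [hz] and [hy]. Their
    sum ties [a], [b] and [c], so it lies in the chamber [e], which reads [c a b]. By extremality
    [D] contains [hy], and adding it to points of [e] lifts [b] to reach [c b a] and [b c a]. *)
Lemma same_cone_hexagon d a b c : adjacent d a b -> adjacent d b c ->
    same_cone d (swap d b c) -> same_cone d (swap d a b) ->
  let e := swap (swap d b c) a c in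
  same_cone e (swap e a b) /\ same_cone e (swap (swap e a b) b c).
Proof.
move=> ab bc s1 s2 e.
have [_ [A1 A2 A3 [B1 B2]] _ _ [[nab nac nbc] _]] := hexagon ab bc.
rewrite -/e in A2 A3.
have [C [FC d1C dC]] : exists C, [/\ F C, Sn_cone (swap d b c) `<=` C &
    Sn_cone (swap d a b) `<=` C].
  by apply/same_coneP/(same_cone_trans _ s2); rewrite same_cone_sym.
have [D FD eD] := chamber_in_fan e.
pose K := before_set d a.
have d1K : K = before_set (swap d b c) a by rewrite before_set_swap_out.
have d2K : K = before_set (swap d a b) b by rewrite before_set_swapr.
have eK : K = before_set e c by rewrite /e before_set_swapr.
pose hy x : nat := if x \in K then 2%N else x == b.
pose hz x : nat := if x \in K then 2%N else (x == a) || (x == c).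
have Dy : D (nat_vec R hy).
  apply: (fan_extreme (u := nat_vec R hz) FC FD).
  - apply/d1C/nat_vec_Sn_cone => x y.
    have A1' := adjacent_swap bc.
    rewrite /hz d1K !inE !(eq_pos (swap d b c)).
    by do ?[case: ifP => ?]; lia.
  - apply/dC/nat_vec_Sn_cone => x y.
    have A1' := adjacent_swap ab.
    rewrite /hy d2K !inE !(eq_pos (swap d a b)).
    by do ?[case: ifP => ?]; lia.
  - rewrite nat_vecD; apply/eD/nat_vec_Sn_cone => x y.
    have A1' := adjacent_swap A1; rewrite -/e in A1'.
    rewrite /hy /hz eK !inE !(eq_pos e).
    by do ?[case: ifP => ?]; lia.
have Dk k : D (nat_vec R (fun x => 2 * height e x + k * hy x)%N).
  rewrite -nat_vecD; apply: polyhedral_coneD; first exact: polyF.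
    by apply/eD/nat_vec_Sn_cone => x y xy; rewrite leq_mul2l /height; lia.
  by rewrite -nat_vecZ; apply: polyhedral_coneZ; rewrite ?ler0n //; apply: polyF.
have A1' := adjacent_swap A1; rewrite -/e in A1'.
have [st3 st5] := lifted_heights A1' A2.
split; apply/same_coneP; exists D; split=> //.
  apply: (Sn_cone_subset FD _ (Dk 3%N)); apply: nat_vec_strictly_sorted => x y xy.
  by have := st3 x y xy; rewrite /hy eK !inE.
apply: (Sn_cone_subset FD _ (Dk 5%N)); apply: nat_vec_strictly_sorted => x y xy.
by have := st5 x y xy; rewrite /hy eK !inE.
Qed.

Lemma removed_CI_semigraphoid : semigraphoid (removed_CI (fan_partition F)).
Proof.
split=> [t /removed_CIP[d [a [b [ab _ ->]]]]|i j l K ijl KC Mij Mil].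
  exact: wall_CI_statement.
have [d [li ij dK]] := exists_hexagon ijl KC.
have [E [A1 A2 A3 [B1 B2]] [L1 L2 L3] [L4 L5 L6] _] := hexagon li ij.
rewrite dK in L1 L2 L3 L4 L5 L6.
have s1 : same_cone d (swap d i j) by apply: removed_CI_wall; rewrite ?L4.
have s2 : same_cone d (swap d l i) by apply: removed_CI_wall; rewrite ?L1 1?CIC.
have [s3 s4] := same_cone_hexagon li ij s1 s2.
rewrite -E in s3 s4.
have Ed (f : 'S_n) : swap (swap f i j) i j = f by rewrite swapC swapK.
rewrite Ed in s4.
split; apply/removed_CIP.
  exists (swap (swap d l i) l j), i, j; split=> //.
  by apply: same_cone_trans s3; rewrite same_cone_sym.
by exists (swap (swap d i j) l j), l, i; split; rewrite // ?L6 1?CIC // -E.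
Qed.

End Coarsening.

(** * Injectivity and the bijection *)

Lemma removed_CI_inj (R : realType) (n : nat) (F G : set (set 'cV[R]_n)) :
  Sn_coarsening F -> Sn_coarsening G ->
  removed_CI (fan_partition F) `<=` removed_CI (fan_partition G) ->
  forall d e : 'S_n, same_cone F d e -> same_cone G d e.
Proof.
move=> cF cG FG d e; have [m] := ubnP (inversions d e); elim: m d => // m IH d lt_m.
have [<- _|/eqP de Fde] := eqVneq d e; first exact: same_cone_refl.
have [a [b [ab ba]]] := adjacent_inversion de.
have /(same_coneP cF)[C [FC dC eC]] := Fde.
have pC : polyhedral_cone C by case: cF => -[_ + _ _] _; apply.
have sC : Sn_cone (swap d a b) `<=` C.
  (* A point inside the wall, pushed slightly towards [e]: heights in [e] differ by less than [n],
     so the factor [n.+1] lets [e] decide only the tie of [a] and [b]. By convexity the point is in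
     [C]. *)
  pose h x := (n.+1 * (height d x + height (swap d a b) x) + height e x)%N.
  have Ch : C (nat_vec R h).
    rewrite /h -nat_vecD; apply: (polyhedral_coneD pC); last exact/eC/height_Sn_cone.
    rewrite -nat_vecZ; apply: (polyhedral_coneZ pC); rewrite ?ler0n //.
    apply/dC/nat_vec_Sn_cone => x y; rewrite /height !pos_swap !(eq_pos d).
    by do ?[case: ifP => ?]; lia.
  apply: (Sn_cone_subset cF FC _ Ch); apply: nat_vec_strictly_sorted => x y xy.
  have [[-> ->]|lt] : (x = b /\ y = a) \/
      (height d y + height (swap d a b) y < height d x + height (swap d a b) x)%N.
    have [/andP[/eqP -> /eqP ->]|] := boolP ((x == b) && (y == a)); first by left.
    move: xy; have := pos_lt d x; have := pos_lt d b; have := pos_lt d a.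
    rewrite /height !pos_swap !(eq_pos d) => ? ? ? xy nxy; right; move: xy nxy.
    by do ?[case: ifP => ?; try (exfalso; lia)]; lia.
  - rewrite /h /height pos_swapl pos_swapr [X in (_ * X + _ < _)%N]addnC ltn_add2l.
    by have := pos_lt e a; lia.
  - rewrite /h; have := leq_mul (leqnn n.+1) lt; rewrite mulnS.
    by rewrite /height; lia.
have Fds : same_cone F d (swap d a b) by apply/(same_coneP cF); exists C.
have Fse : same_cone F (swap d a b) e by apply/(same_coneP cF); exists C.
have Gds : same_cone G d (swap d a b).
  apply: (removed_CI_wall cG ab); apply: FG; apply/(removed_CIP cF).
  by exists d, a, b.
apply: (same_cone_trans cG Gds); apply: IH Fse.
by rewrite -(inversions_swap ab ba) ltnS in lt_m.
Qed.

Theorem theorem3 (R : realType) (n : nat) (n_gt0 : (0 < n)%N) :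
  set_bij (@convex_rank_test R n) (@semigraphoid n) (@removed_CI n).
Proof.
split.
- by move=> P [F [cF ->]]; apply: removed_CI_semigraphoid.
- move=> P Q /set_mem[F [cF ->]] /set_mem[G [cG ->]] FG.
  rewrite /fan_partition; congr equivalence_partition.
  apply/funext => d; apply/funext => e.
  by apply/idP/idP; apply: removed_CI_inj => //; rewrite FG.
- move=> M sgM; exists (fan_partition (@class_fan R n M)).
    by exists (@class_fan R n M); split=> //; apply: class_fan_coarsening.
  exact: removed_CI_class_fan.
Qed.
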